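(* The entries $\dfrac{1}{t-1}$ and $-\dfrac{1}{t(t-1)}$ of the matrix $$B_2(t)=\begin{pmatrix}t&t\\t&t^2\end{pmatrix}^{-1}=\begin{pmatrix}\frac1{t-1}&-\frac1{t(t-1)}\\-\frac1{t(t-1)}&\frac1{t(t-1)}\end{pmatrix}$$ cannot be Hilbert polynomials of finite-dimensional $\mathbb Z$-graded vector spaces; that is, neither of these rational functions in $t$ is equal to $\operatorname{Hilb}(M)$ for any finite-dimensional $\mathbb Z$-graded vector space $M$ over a field.
   Context: For a finite-dimensional $\mathbb Z$-graded vector space $M=\bigoplus_{i\in\mathbb Z}M_i$ over a field $\mathbf k$, its Hilbert polynomial is $\operatorname{Hilb}(M)=\sum_{i}\dim_{\mathbf k}(M_i)\,t^i\in\mathbb Z[t,t^{-1}]$, regarded as an element of the field $\mathbb Q(t)$ of rational functions in the indeterminate $t$. *)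

(* Defs.v *)
From HB Require Import structures.
From mathcomp Require Import all_boot all_order all_algebra.
From mathcomp Require Import boolp classical_sets functions cardinality fsbigop.

Set Implicit Arguments.
Unset Strict Implicit.
Unset Printing Implicit Defensive.

Import GRing.Theory.
Local Open Scope ring_scope.

Notation Qt := {fraction {poly rat}}.

Definition t : Qt := tofrac ('X : {poly rat}).

(* V = \bigoplus_(i in Z) M i, internally: any finitely many of the distinct
   components are in direct sum, and every vector is a finite sum of
   homogeneous vectors.  Components may be zero. *)
Definition is_grading (k : fieldType) (V : vectType k)
    (M : int -> {vspace V}) : Prop :=
  (forall s : seq int, uniq s -> directv (\sum_(i <- s) M i)%VS) /\
  (forall v : V, exists s : seq int, v \in (\sum_(i <- s) M i)%VS).

(* The sum ranges over the i whose term is nonzero and is 0 by convention when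
   there are infinitely many of them; is_grading_finite_support excludes the
   latter for gradings. *)
Definition Hilb (k : fieldType) (V : vectType k) (M : int -> {vspace V}) : Qt :=
  \sum_(i \in [set: int]) (\dim (M i))%:R * t ^ i.

Lemma is_grading_finite_support (k : fieldType) (V : vectType k)
    (M : int -> {vspace V}) :
  is_grading M -> finite_set [set i | M i != 0%VS].
Proof.
move=> [dM cM].
have [s fs] : exists s : seq int, (fullv <= \sum_(i <- s) M i)%VS.
  suff H (X : seq V) : exists s : seq int, {subset X <= (\sum_(i <- s) M i)%VS}.
    have [s sP] := H (vbasis fullv); exists s.
    by rewrite -(span_basis (vbasisP fullv)); apply/span_subvP.
  elim: X => [|v X [s sP]]; first by exists [::].
  have [r rP] := cM v; exists (r ++ s) => w; rewrite big_cat /= inE.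
  move=> /orP[/eqP->|/sP ws]; first exact: (subvP (addvSl _ _)).
  exact: (subvP (addvSr _ _)).
apply: (@sub_finite_set _ _ [set` s]); last exact: finite_seq.
move=> i /= Mi; apply: contraNT Mi => nis.
have fu : (\sum_(j <- undup s) M j = fullv)%VS.
  apply/eqP; rewrite eqEsubv subvf /=; apply: subv_trans fs _.
  rewrite big_seq; apply big_ind => [|U W ? ?|j js].
  - exact: sub0v.
  - by rewrite subv_add; apply/andP.
  - by rewrite (big_rem j) ?mem_undup //= addvSl.
have us : uniq (i :: undup s) by rewrite /= mem_undup nis undup_uniq.
have /directvP /= := dM _ us.
have /directvP /= := dM _ (undup_uniq s).
rewrite !big_cons fu => <-.
rewrite addvC (addv_idPl (subvf _)) => /eqP.
by rewrite -{1}[\dim fullv]add0n eqn_add2r eq_sym dimv_eq0.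
Qed.

Definition mx2 (R : Type) (a b c d : R) : 'M[R]_2 :=
  \matrix_(i < 2, j < 2)
    if i == ord0 then (if j == ord0 then a else b)
    else (if j == ord0 then c else d).

Definition B2 : 'M[Qt]_2 := invmx (mx2 t t t (t ^+ 2)).

(* Main.v *)
Require Import Defs.
From mathcomp Require Import all_boot all_order all_algebra.
From mathcomp Require Import ring.

Import GRing.Theory.
Local Open Scope ring_scope.

(** A Hilbert polynomial is a finite sum of terms [c * t ^ i], hence a Laurent
polynomial, and a Laurent polynomial has no pole at [1], because the only
denominators it allows are powers of [t], which do not vanish there
([laurent_Hilb], [laurent_no_pole_at_1]).  Both excluded entries have a simple
pole at [1]: multiplying them by [X - 1], respectively [X * (X - 1)], which
vanish at [1], yields the constants [1] and [-1], which do not.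

The invertibility of the matrix and the formula for its inverse both follow
from one matrix product ([mulmx_mx2_inv]), a right inverse of a square matrix
over a field being two-sided. *)

(** Denominators are cleared by a single natural power of [t], so that values at
[1] can be read off a genuine polynomial. *)
Definition laurent (f : Qt) : Prop :=
  exists n : nat, exists p : {poly rat}, f * t ^+ n = tofrac p.

Lemma t_neq0 : t != 0.
Proof. by rewrite tofrac_eq0 polyX_eq0. Qed.

Lemma t_sub1_neq0 : t - 1 != 0.
Proof. by rewrite -tofrac1 -tofracB tofrac_eq0 polyXsubC_eq0. Qed.

Lemma laurent0 : laurent 0.
Proof. by exists 0, 0; rewrite mul0r tofrac0. Qed.

Lemma laurentD (f g : Qt) : laurent f -> laurent g -> laurent (f + g).
Proof.
move=> [m [p fp]] [n [q gq]]; exists (m + n), (p * 'X^n + q * 'X^m).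
rewrite tofracD !tofracM !tofracXn -fp -gq -/t exprD; ring.
Qed.

Lemma laurent_monomial (d : nat) (i : int) : laurent (d%:R * t ^ i).
Proof.
case: i => n; first by exists 0, (d%:R * 'X^n);
  rewrite mulr1 tofracM tofracXn tofracMn tofrac1.
exists n.+1, d%:R; rewrite NegzE -exprnN -mulrA mulVf ?expf_neq0 ?t_neq0 //.
by rewrite mulr1 tofracMn tofrac1.
Qed.

Lemma laurent_Hilb (k : fieldType) (V : vectType k) (M : int -> {vspace V}) :
  laurent (Hilb M).
Proof.
rewrite /Hilb; elim/big_ind: _ => [|f g|i _].
- exact: laurent0.
- exact: laurentD.
- exact: laurent_monomial.
Qed.

(** Evaluation at [1] is not defined on all rational functions, so the absence
of a pole is expressed through a product [f * r = q] with polynomials [r] and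
[q].  With [f = p / X^n] it becomes the polynomial identity [q * X^n = p * r],
which can be evaluated at [1], where [X^n] takes the value [1]. *)
Lemma laurent_no_pole_at_1 (f : Qt) (r q : {poly rat}) :
  laurent f -> f * tofrac r = tofrac q -> root r 1 -> root q 1.
Proof.
move=> [n [p fp]] fr /rootP r1.
have /(congr1 (horner^~ 1)) : q * 'X^n = p * r.
  by apply/eqP; rewrite -tofrac_eq !tofracM tofracXn -fr -fp -/t mulrAC.
by rewrite !hornerE r1 expr1n mulr1 mulr0 => /rootP.
Qed.

Lemma mulmx_mx2 (R : nzRingType) (a b c d a' b' c' d' : R) :
  mx2 a b c d *m mx2 a' b' c' d' =
  mx2 (a * a' + b * c') (a * b' + b * d') (c * a' + d * c') (c * b' + d * d').
Proof.
by apply/matrixP=> i j; rewrite !mxE !big_ord_recl big_ord0 addr0 !mxE /=;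
  case: eqP; case: eqP.
Qed.

Lemma mx2_1 (R : nzRingType) : mx2 1 0 0 1 = 1%:M :> 'M[R]_2.
Proof.
by apply/matrixP=> -[[|[|//]] ?] -[[|[|//]] ?]; rewrite !mxE.
Qed.

(** The determinant of the left factor is [x ^+ 2 * (x - 1)], which explains the
two nonvanishing hypotheses. *)
Lemma mulmx_mx2_inv (F : fieldType) (x : F) : x != 0 -> x - 1 != 0 ->
  mx2 x x x (x ^+ 2) *m
    mx2 (1 / (x - 1)) (- (1 / (x * (x - 1))))
        (- (1 / (x * (x - 1)))) (1 / (x * (x - 1))) = 1%:M.
Proof.
move=> x0 x1; rewrite mulmx_mx2 -mx2_1.
by congr mx2; field; rewrite x0 x1.
Qed.

Theorem proposition8p1 :
  [/\ mx2 t t t (t ^+ 2) \in unitmx,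
      B2 = mx2 (1 / (t - 1))           (- (1 / (t * (t - 1))))
               (- (1 / (t * (t - 1)))) (1 / (t * (t - 1))) &
      forall (k : fieldType) (V : vectType k) (M : int -> {vspace V}),
        is_grading M ->
        Hilb M <> 1 / (t - 1) /\ Hilb M <> - (1 / (t * (t - 1)))].
Proof.
have t0 := t_neq0; have t1 := t_sub1_neq0.
have AB := mulmx_mx2_inv _ _ t0 t1; have [unitA _] := mulmx1_unit AB.
split=> // [|k V M _]; first by rewrite /B2 -[LHS]mulmx1 -AB mulKmx.
have LH := laurent_Hilb _ _ M.
have Xsub1 : tofrac ('X - 1%:P : {poly rat}) = t - 1 by rewrite tofracB tofrac1.
split=> HM; rewrite {}HM in LH.
- have : root (1 : {poly rat}) 1.
    apply: (laurent_no_pole_at_1 _ ('X - 1%:P) _ LH); last by rewrite root_XsubC.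
    by rewrite Xsub1 tofrac1 (divfK t1).
  by apply/negP; exact: root1.
- have : root (- 1 : {poly rat}) 1.
    apply: (laurent_no_pole_at_1 _ ('X * ('X - 1%:P)) _ LH).
      by rewrite tofracM Xsub1 tofracN tofrac1 -/t mulNr (divfK (mulf_neq0 t0 t1)).
    by rewrite rootM root_XsubC eqxx orbT.
  by rewrite rootN; apply/negP; exact: root1.
Qed.
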